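(* The Nørlund–Bernoulli polynomials $\mathcal{B}^{(\gamma)}_k$ satisfy, for all integers $m\ge0$ and all complex $t,x$, $$\frac{(t-x+1)_{m}}{m!}\mathcal{B}^{(t-x+m+1)}_{m}(1-x)=\sum_{j=0}^{m}\mathcal{B}^{(t-x+1)}_{j}(t)\frac{(x-t)_j}{j!}\sum_{k=0}^{m-j}(-1)^k\binom{m}{k}s(m-k,j)(t)_k$$ and $$\frac{1}{m!}\sum_{j=0}^{m}s(m,j)\mathcal{B}^{(t+x)}_{j}(t)\frac{(1-t-x)_j}{j!}=\sum_{j=0}^{m}\binom{t}{m-j}\mathcal{B}^{(t+x+j)}_{j}(x)\frac{(t+x)_j}{(j!)^2},$$ where $s(m,j)$ is the Stirling number of the first kind.
   Context: Nørlund–Bernoulli (generalized Bernoulli) polynomials $\mathcal{B}^{(\gamma)}_k(x)$, $\gamma\in\mathbb{C}$, are defined by $\dfrac{t^{\gamma}e^{xt}}{(e^t-1)^{\gamma}}=\sum_{k=0}^\infty \mathcal{B}^{(\gamma)}_k(x)\dfrac{t^k}{k!}$. $(x)_0=1$, $(x)_n=x(x+1)\cdots(x+n-1)$ for $n\ge1$. Stirling numbers of the first kind $s(n,j)$ are defined by $x(x-1)\cdots(x-n+1)=\sum_{j=0}^{n}s(n,j)x^j$. For complex $t$, $\binom{t}{n}=t(t-1)\cdots(t-n+1)/n!$. *)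

(* Defs.v *)
From HB Require Import structures.
From mathcomp Require Import all_boot all_order all_algebra.
From mathcomp Require Import reals complex.

Set Implicit Arguments.
Unset Strict Implicit.
Unset Printing Implicit Defensive.

Import Order.TTheory GRing.Theory Num.Theory.
Local Open Scope ring_scope.

Definition rising (K : numFieldType) (x : K) (n : nat) : K :=
  \prod_(i < n) (x + i%:R).

Definition gbinom (K : numFieldType) (a : K) (n : nat) : K :=
  (\prod_(i < n) (a - i%:R)) / n`!%:R.

(* Signed Stirling numbers of the first kind: the coefficients of
   X (X - 1) ... (X - n + 1). *)
Definition stirling1 (n j : nat) : int :=
  (\prod_(i < n) ('X - (i%:Z)%:P) : {poly int})`_j.

(* A formal power series \sum_n f_n T^n over K is the sequence of its
   (ordinary) coefficients. *)
Definition fps (K : numFieldType) : Type := nat -> K.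

Definition fps_one (K : numFieldType) : fps K := fun n => (n == 0%N)%:R.

Definition fps_mul (K : numFieldType) (f g : fps K) : fps K :=
  fun n => \sum_(i < n.+1) f i * g (n - i)%N.

Definition fps_exprn (K : numFieldType) (f : fps K) (n : nat) : fps K :=
  iter n (fps_mul f) (fps_one K).

(* f ^ a for a series f with constant term 1 and an exponent a in K, given by
   the binomial series  f ^ a = \sum_n binom(a, n) (f - 1) ^ n  (the branch
   with constant term 1).  As f - 1 has no constant term, only the terms with
   n <= k contribute to the k-th coefficient. *)
Definition fps_pow (K : numFieldType) (f : fps K) (a : K) : fps K :=
  fun k => \sum_(n < k.+1)
    gbinom a n * fps_exprn (fun i => f i - fps_one K i) n k.

(* e^(xT) *)
Definition fps_exp (K : numFieldType) (x : K) : fps K :=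
  fun n => x ^+ n / n`!%:R.

(* (e^T - 1) / T: the coefficients of e^T shifted down by one; its constant
   term is 1. *)
Definition fps_expm1_div (K : numFieldType) : fps K :=
  fun n => fps_exp 1 n.+1.

(* The generating series  T^g e^(xT) / (e^T - 1)^g, read as
   ((e^T - 1) / T) ^ (- g) * e^(xT). *)
Definition norlund_gf (K : numFieldType) (g x : K) : fps K :=
  fps_mul (fps_pow (fps_expm1_div K) (- g)) (fps_exp x).

(* norlund g k x is B^(g)_k(x), i.e. k! times the k-th coefficient of its
   generating series. *)
Definition norlund (K : numFieldType) (g : K) (k : nat) (x : K) : K :=
  k`!%:R * norlund_gf g x k.

(* Main.v *)
Require Import Defs.
From HB Require Import structures.
From mathcomp Require Import all_boot all_order all_algebra.
From mathcomp Require Import reals complex ring zify.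

Set Implicit Arguments.
Unset Strict Implicit.
Unset Printing Implicit Defensive.

Import Order.TTheory GRing.Theory Num.Theory.
Local Open Scope ring_scope.
Local Open Scope complex_scope.

(** Put g = t - x + 1 in the first identity, g = t + x in the second, and keep
    t fixed: all Nörlund polynomials then have an order and an argument affine
    in g, so both sides are polynomial functions of g and it suffices to compare
    them at g = n + 1 for all n ([polyfun_eq]).

    At a positive integer order the Nörlund polynomials are visible as
    coefficients of a product of linear factors ([coef_falling_norlund]):
      C(n, k) B^(n+1)_k(x) = [y^(n-k)] (x + y - 1)(x + y - 2) ... (x + y - n).
    It comes from the recurrence in the order ([norlund_gf_rec])
      g w(g+1, k) = (g - k) w(g, k) + (x - g) w(g, k-1),
    where w(g, k) = B^(g)_k(x) / k!.

    Write A(y) = (t + y - 1) ... (t + y - n), and p^_m for the falling factorial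
    p (p - 1) ... (p - m + 1).  At g = n + 1 the number (1 - g)_j / j! is
    (-1)^j C(n, j), so a sum over j of B^(n+1)_j(t) (1 - g)_j / j! times
    (-1)^j q_j is the convolution [y^n] A(y) q(y) ([norlund_convolution]).  The
    Stirling numbers are the coefficients of such a q: of (-y)^_m in the second
    identity, and of (-y - t)^_m, expanded by Vandermonde, in the first.  On the
    other side, y |-> -y turns the product attached to B^(n+m+1)_m(n + 1 - t)
    into (-1)^n A(y) (-t - y)^_m, and multiplies [y^n] by the same sign
    ([norlund_reflected]).  Hence the two sides
    of the first identity are both [y^n] A(y) (-y - t)^_m, and those of the
    second are both [y^n] A(y) (-y)^_m / m!, by Vandermonde for
    -y = (-t - y) + t. *)

(** * Falling factorials in a commutative ring *)

(** The ring is arbitrary because falling factorials of scalars and of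
    polynomials in an auxiliary variable both occur. *)
Definition falling (A : comNzRingType) (a : A) (n : nat) : A :=
  \prod_(i < n) (a - i%:R).

Lemma fallingS (A : comNzRingType) (a : A) n :
  falling a n.+1 = falling a n * (a - n%:R).
Proof. by rewrite /falling big_ord_recr. Qed.

Lemma falling0 (A : comNzRingType) (a : A) : falling a 0 = 1.
Proof. by rewrite /falling big_ord0. Qed.

Lemma fallingSl (A : comNzRingType) (a : A) n :
  falling a n.+1 = a * falling (a - 1) n.
Proof.
rewrite /falling big_ord_recl subr0; congr (_ * _); apply: eq_bigr => i _.
by rewrite /bump /= natrD opprD addrA.
Qed.

Lemma fallingD (A : comNzRingType) (a : A) n m :
  falling a (n + m) = falling a n * falling (a - n%:R) m.
Proof.
elim: m => [|m IH]; first by rewrite addn0 falling0 mulr1.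
by rewrite addnS !fallingS IH natrD opprD !addrA mulrA.
Qed.

Lemma falling_Vandermonde (A : comNzRingType) (a b : A) m :
  falling (a + b) m =
  \sum_(k < m.+1) 'C(m, k)%:R * falling a k * falling b (m - k).
Proof.
elim: m => [|m IH].
  by rewrite big_ord_recl big_ord0 /= !falling0 bin0 !mulr1 addr0.
rewrite big_ord_recl /= bin0 mul1r falling0 mul1r subn0.
under eq_bigr => i _.
  rewrite /bump /= add1n binS subSS natrD mulrDl mulrDl.
  over.
rewrite big_split /= addrA.
rewrite [X in _ + X + _]big_ord_recr /= bin_small // !mul0r addr0.
have -> : falling b m.+1 + \sum_(i < m)
    'C(m, i.+1)%:R * falling a i.+1 * falling b (m - i)
  = \sum_(i < m.+1) 'C(m, i)%:R * falling a i * falling b (m - i).+1.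
  rewrite big_ord_recl /= bin0 falling0 !mul1r subn0; congr (_ + _).
  apply: eq_bigr => i _; rewrite /bump /= add1n; congr (_ * falling _ _).
  by have := ltn_ord i; lia.
rewrite -big_split /= fallingS IH mulr_suml; apply: eq_bigr => k _.
rewrite !fallingS natrB; last by rewrite -ltnS.
ring.
Qed.

(** Reversing the order of the factors a, a - 1, ..., a - n + 1 and changing
    the sign of each of them gives n - 1 - a, n - 2 - a, ..., - a. *)
Lemma falling_reflect (A : comNzRingType) (a : A) n :
  falling (n%:R - 1 - a) n = (-1) ^+ n * falling a n.
Proof.
elim: n => [|n IH]; first by rewrite !falling0 mulr1.
rewrite fallingSl.
have -> : n.+1%:R - 1 - a - 1 = n%:R - 1 - a :> A by rewrite -natr1; ring.
by rewrite IH fallingS exprS -natr1; ring.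
Qed.

Lemma risingE (K : numFieldType) (a : K) n :
  rising a n = (-1) ^+ n * falling (- a) n.
Proof.
elim: n => [|n IH]; first by rewrite /rising falling0 big_ord0 mulr1.
by rewrite fallingS /rising big_ord_recr /= -/(rising _ _) IH exprS; ring.
Qed.

Lemma falling_nat (A : comNzRingType) n k :
  falling (n%:R : A) k = (n ^_ k)%:R.
Proof.
elim: k => [|k IH]; first by rewrite falling0 ffactn0.
rewrite fallingS IH ffactnSr natrM.
have [le_kn|lt_nk] := leqP k n; first by rewrite natrB.
by rewrite ffact_small // !mul0r.
Qed.

(** * Binomial powers of a series, truncated to polynomials *)

Lemma gbinomE (K : numFieldType) (a : K) n :
  gbinom a n = falling a n / n`!%:R.
Proof. by []. Qed.

Lemma natf_neq0 (K : numFieldType) n : n.+1%:R != 0 :> K.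
Proof. by rewrite pnatr_eq0. Qed.

Lemma fact_neq0 (K : numFieldType) n : n`!%:R != 0 :> K.
Proof. by rewrite pnatr_eq0 -lt0n fact_gt0. Qed.

Lemma gbinomS (K : numFieldType) (a : K) n :
  n.+1%:R * gbinom a n.+1 = a * gbinom (a - 1) n.
Proof.
rewrite !gbinomE fallingSl factS natrM.
by field; rewrite fact_neq0 nat1r natf_neq0.
Qed.

Lemma gbinom_Pascal (K : numFieldType) (a : K) n :
  gbinom a n.+1 = gbinom (a - 1) n.+1 + gbinom (a - 1) n.
Proof.
rewrite !gbinomE fallingSl fallingS factS natrM.
by field; rewrite fact_neq0 nat1r natf_neq0.
Qed.

(** The binomial series for (1 + U) ^ a cut after N terms.  When 'X divides U,
    its coefficients below degree N are those of the full power, so identities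
    between powers of series become identities of polynomials modulo 'X^N. *)
Definition trunc_pow (K : numFieldType) (U : {poly K}) (a : K) N : {poly K} :=
  \sum_(n < N) gbinom a n *: U ^+ n.

(** (1 + U) (1 + U) ^ (a - 1) = (1 + U) ^ a, by Pascal's rule; truncation only
    leaves an error in the last power of U. *)
Lemma trunc_pow_mul1D (K : numFieldType) (U : {poly K}) a N :
  (1 + U) * trunc_pow U (a - 1) N.+1 =
  trunc_pow U a N.+1 + gbinom (a - 1) N *: U ^+ N.+1.
Proof.
elim: N => [|N IH].
  rewrite /trunc_pow !big_ord_recl !big_ord0 /= !addr0 !gbinomE !falling0.
  by rewrite divr1 !scale1r expr0 expr1 mulr1.
rewrite /trunc_pow !(big_ord_recr N.+1) /= -!/(trunc_pow _ _ _) mulrDr IH.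
rewrite (gbinom_Pascal a) scalerDl [U ^+ N.+2]exprS -!mul_polyC.
ring.
Qed.


(** The chain rule for (1 + U) ^ a; it is exact here, since derivation removes
    the last term on the left and the right side is cut one term earlier. *)
Lemma trunc_pow_deriv (K : numFieldType) (U : {poly K}) a N :
  (trunc_pow U a N.+1)^`() = a *: (U^`() * trunc_pow U (a - 1) N).
Proof.
rewrite /trunc_pow big_ord_recl derivD expr0 derivZ derivC scaler0 add0r.
rewrite raddf_sum mulr_sumr scaler_sumr; apply: eq_bigr => i _.
rewrite lift0 [LHS]derivZ deriv_exp /= -scalerAr scalerA -gbinomS.
by rewrite -scaler_nat scalerA mulrC.
Qed.

Lemma coef_XnM_low (K : numFieldType) N (r : {poly K}) k : (k < N)%N ->
  ('X^N * r)`_k = 0.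
Proof. by move=> lt_kN; rewrite coefXnM lt_kN. Qed.

Lemma coef_fps_mul (K : numFieldType) N (p q : {poly K}) (f g : fps K) :
  (forall i, (i < N)%N -> p`_i = f i) -> (forall i, (i < N)%N -> q`_i = g i) ->
  forall i, (i < N)%N -> (p * q)`_i = fps_mul f g i.
Proof.
move=> pf qg i lt_iN; rewrite coefM; apply: eq_bigr => j _.
rewrite pf ?qg //; first exact: leq_ltn_trans (leq_subr _ _) lt_iN.
by apply: leq_ltn_trans lt_iN; rewrite -ltnS.
Qed.

Lemma coef_fps_exprn (K : numFieldType) N (p : {poly K}) (f : fps K) n :
  (forall i, (i < N)%N -> p`_i = f i) ->
  forall i, (i < N)%N -> (p ^+ n)`_i = fps_exprn f n i.
Proof.
move=> pf; elim: n => [|n IH] i lt_iN.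
  by rewrite expr0 coef1.
by rewrite exprS (coef_fps_mul pf IH).
Qed.

Lemma coef_fps_pow (K : numFieldType) N (V : {poly K}) (f : fps K) a :
  (forall i, (i < N)%N -> (1 + 'X * V)`_i = f i) ->
  forall i, (i < N)%N -> (trunc_pow ('X * V) a N)`_i = fps_pow f a i.
Proof.
move=> Vf i lt_iN; rewrite /trunc_pow coef_sum /fps_pow.
rewrite (big_ord_widen N (fun n =>
  gbinom a n * fps_exprn (fun i => f i - fps_one K i) n i)) //.
rewrite [RHS]big_mkcond; apply: eq_bigr => n _.
rewrite coefZ; rewrite ltnS; case: leqP => [le_ni | lt_in].
  congr (_ * _); apply: (@coef_fps_exprn _ N) => // j lt_jN.
  by rewrite -Vf // coefD coef1 addrAC subrr add0r.
by rewrite exprMn coef_XnM_low ?mulr0.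
Qed.

Lemma eq_coef_modXn (K : numFieldType) N (p q : {poly K}) :
  (forall i, (i < N)%N -> p`_i = q`_i) -> exists r, p = q + 'X^N * r.
Proof.
move=> pq; exists (drop_poly N (p - q)).
rewrite mulrC -[LHS](subrK q) addrC; congr (_ + _).
rewrite -[LHS](poly_take_drop N); have -> : take_poly N (p - q) = 0; last first.
  by rewrite add0r.
apply/polyP => i; rewrite coef_take_poly coef0.
by case: ifP => // lt_iN; rewrite coefB pq // subrr.
Qed.

(** Let W_g = E^(-g) e^(xT) with E = (e^T - 1) / T.  From T E' = T E + 1 - E one
    gets
      T W_g' = - g T W_g - g W_(g+1) + g W_g + x T W_g,
    whose coefficient of T^(k+1) is the recurrence.  The computation is done
    with polynomials modulo T^(k+2), r, r1, ..., r4 being the quotients of the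
    error terms. *)
Lemma norlund_gf_rec (K : numFieldType) (g x : K) k :
  g * norlund_gf (g + 1) x k.+1 =
  (g - k.+1%:R) * norlund_gf g x k.+1 + (x - g) * norlund_gf g x k.
Proof.
pose N := k.+2.
pose V : {poly K} := \poly_(i < N) fps_expm1_div K i.+1.
pose U : {poly K} := 'X * V.
pose e : {poly K} := \poly_(i < N) fps_exp x i.
have UE i : (i < N)%N -> (1 + U)`_i = fps_expm1_div K i.
  move=> lt_iN; rewrite coefD coef1 coefXM.
  case: i lt_iN => [|i] lt_iN /=.
    by rewrite addr0 /fps_expm1_div /fps_exp expr1n divr1.
  by rewrite add0r coef_poly (ltnW lt_iN).
have ee i : (i < N)%N -> e`_i = fps_exp x i.
  by move=> lt_iN; rewrite coef_poly lt_iN.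
have W a i : (i < N)%N -> (trunc_pow U (- a) N * e)`_i = norlund_gf a x i.
  apply: (coef_fps_mul _ ee) => {}i; exact: coef_fps_pow.
have [r1 De] : exists r, 'X * e^`() = 'X * (x *: e) + 'X^N * r.
  apply: eq_coef_modXn => i lt_iN; rewrite !coefXM; case: i lt_iN => //= i lt_iN.
  rewrite coef_deriv coefZ !ee ?(ltnW lt_iN) // /fps_exp exprS factS natrM.
  by rewrite -mulr_natl; field; rewrite fact_neq0 nat1r natf_neq0.
(* T E' = T E - (E - 1), with E = 1 + U *)
have [r2 DU] : exists r, 'X * U^`() = 'X * (1 + U) - U + 'X^N * r.
  have -> : 'X * U^`() = 'X * (1 + U)^`() by rewrite derivD -polyC1 derivC add0r.
  have -> : 'X * (1 + U) - U = 'X * (1 + U) - (1 + U - 1).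
    by rewrite [1 + U - 1]addrAC subrr add0r.
  apply: eq_coef_modXn => i lt_iN; rewrite !(coefB, coefXM) coef1.
  case: i lt_iN => [|i] lt_iN /=.
    by rewrite UE // /fps_expm1_div /fps_exp expr1n divr1 subrr subr0.
  rewrite coef_deriv !UE ?(ltnW lt_iN) // /fps_expm1_div /fps_exp !expr1n subr0.
  rewrite !(factS i.+1) natrM -mulr_natl; field.
  by rewrite fact_neq0 -natrD natf_neq0.
pose P := trunc_pow U (- g) N.
pose P1 := trunc_pow U (- g - 1) N.
have [r3 DP] : exists r, 'X * P^`() = - g *: ('X * U^`() * P1) + 'X^N * r.
  exists (g *: (U^`() * (gbinom (- g - 1) k.+1 *: V ^+ k.+1))).
  rewrite /P trunc_pow_deriv /P1 {2}/trunc_pow big_ord_recr /=.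
  rewrite -/(trunc_pow U _ k.+1) exprMn /N (exprS _ k.+1) -!mul_polyC polyCN.
  by set Z := 'X^(k.+1); set D := U^`(); ring.
have [r4 PP1] : exists r, (1 + U) * P1 = P + 'X^N * r.
  exists (gbinom (- g - 1) k.+1 *: V ^+ N).
  rewrite /P1 trunc_pow_mul1D exprMn /N -!mul_polyC.
  by rewrite mulrCA.
(* The differential equation of W_g, with P = E^(-g) and P1 = E^(-g-1) *)
have [r E] : exists r, 'X * (P * e)^`() =
    - g%:P * ('X * (P * e)) - g%:P * (P1 * e) + g%:P * (P * e)
    + x%:P * ('X * (P * e)) + 'X^N * r.
  exists (- g%:P * 'X * e * r4 + g%:P * e * r4 - g%:P * r2 * P1 * e + r3 * e
    + P * r1).
  transitivity ('X * P^`() * e + P * ('X * e^`())); first by rewrite derivM; ring.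
  rewrite DP De DU -!mul_polyC polyCN.
  transitivity (- g%:P * ('X * ((1 + U) * P1) - ((1 + U) * P1 - P1) +
     'X^N * r2 * P1) * e + 'X^N * r3 * e + P * ('X * (x%:P * e) + 'X^N * r1)).
    ring.
  by rewrite PP1; ring.
have W1 : (P1 * e)`_k.+1 = norlund_gf (g + 1) x k.+1.
  by rewrite -W // opprD.
have := congr1 (fun p : {poly K} => p`_k.+1) E.
rewrite !(coefD, coefN, coefCM, coefXM, mulNr) /= coef_XnM_low // coef_deriv.
rewrite W1 !W // addr0 mulrBl [_%:R * _]mulr_natl => ->.
ring.
Qed.

Lemma norlund_gf0 (K : numFieldType) (g x : K) : norlund_gf g x 0 = 1.
Proof.
rewrite /norlund_gf /fps_mul big_ord1 /fps_pow big_ord1 gbinomE falling0.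
by rewrite /fps_exprn /= /fps_one /fps_exp expr0 !divr1 !mulr1.
Qed.

(** * Nörlund polynomials of positive integer order *)

Lemma coef_falling_shiftS (K : numFieldType) (x : K) n i :
  (falling (x%:P + 'X - 1) n.+1)`_i.+1 =
  (falling (x%:P + 'X - 1) n)`_i + (x - n.+1%:R) * (falling (x%:P + 'X - 1) n)`_i.+1.
Proof.
rewrite fallingS.
have -> : x%:P + 'X - 1 - n%:R = 'X + (x - n.+1%:R)%:P :> {poly K}.
  by rewrite polyCB -polyC1 -!(rmorph_nat (@polyC K)) -natr1 polyCD; ring.
by rewrite mulrDr coefD coefMX coefMC mulrC.
Qed.

Lemma size_falling (K : numFieldType) (p : {poly K}) n :
  (size p <= 2)%N -> (size (falling p n) <= n.+1)%N.
Proof.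
move=> sz_p; elim: n => [|n IH]; first by rewrite falling0 size_poly1.
rewrite fallingS (leq_trans (size_polyMleq _ _)) //.
have sz_pn : (size (p - n%:R : {poly K})%R <= 2)%N.
  rewrite (leq_trans (size_polyD _ _)) // geq_max sz_p size_polyN.
  by rewrite -(rmorph_nat (@polyC K)) (leq_trans (size_polyC_leq1 _)).
by have := leq_add IH sz_pn; rewrite addn2; case: (_ + _)%N.
Qed.

(** With 'C(n, k) k! = n ^_ k, multiplying [norlund_gf_rec] at g = n + 1 by
    n ^_ k yields the rule that gives the coefficients of the product when the
    factor x + 'X - (n + 1) is added. *)
Lemma coef_falling_norlund (K : numFieldType) (x : K) n k : (k <= n)%N ->
  (falling (x%:P + 'X - 1) n)`_(n - k) = 'C(n, k)%:R * norlund n.+1%:R k x.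
Proof.
rewrite /norlund mulrA -natrM bin_ffact.
elim: n k => [|n IH] k.
  by rewrite leqn0 => /eqP->; rewrite falling0 coef1 norlund_gf0 mulr1.
case: k => [_|k le_kn].
  rewrite subn0 norlund_gf0 coef_falling_shiftS.
  have := IH 0%N isT; rewrite subn0 norlund_gf0 => ->.
  rewrite nth_default ?mulr0 ?addr0 // size_falling //.
  by rewrite addrAC -polyC1 -polyCB addrC size_XaddC.
have rec := norlund_gf_rec n.+1%:R x k; rewrite natr1 in rec.
rewrite subSS ffactSS natrM mulrAC rec.
have := le_kn; rewrite ltnS leq_eqVlt => /orP[/eqP eq_kn|lt_kn].
  have := IH k le_kn; rewrite eq_kn subnn => a0.
  rewrite fallingS coef0M a0 !(coefD, coefN) coefC coefX coef1 /=.
  rewrite -(rmorph_nat (@polyC K)) coefC /= subrr -natr1; ring.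
rewrite -(subnSK lt_kn) coef_falling_shiftS IH // subnSK // IH //.
rewrite ffactnSr natrM natrB // -!natr1; ring.
Qed.

(** * Coefficients of products of falling factorials *)

Lemma coef_comp_oppX (K : numFieldType) (p : {poly K}) i :
  (p \Po (- 'X))`_i = (-1) ^+ i * p`_i.
Proof.
elim/poly_ind: p i => [|p c IH] i; first by rewrite comp_poly0 !coef0 mulr0.
rewrite comp_polyD comp_polyM comp_polyX comp_polyC mulrN.
rewrite !coefD coefN !coefMX !coefC.
case: i => [|i] /=; first by rewrite oppr0 expr0 mul1r.
by rewrite IH exprS !addr0 mulN1r mulNr.
Qed.

Lemma falling_comp (K : numFieldType) (p q : {poly K}) n :
  falling p n \Po q = falling (p \Po q) n.
Proof.
elim: n => [|n IH]; first by rewrite !falling0 -polyC1 comp_polyC.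
by rewrite !fallingS comp_polyM IH comp_polyB -(rmorph_nat (@polyC K)) comp_polyC.
Qed.

Lemma falling_polyC (K : numFieldType) (a : K) n :
  falling a%:P n = (falling a n)%:P.
Proof.
elim: n => [|n IH]; first by rewrite !falling0.
by rewrite !fallingS polyCM IH polyCB -(rmorph_nat (@polyC K)).
Qed.

Lemma falling_map_int (K : numFieldType) n :
  map_poly intr (falling 'X n : {poly int}) = falling 'X n :> {poly K}.
Proof.
elim: n => [|n IH]; first by rewrite !falling0 rmorph1.
by rewrite !fallingS rmorphM /= IH rmorphB /= map_polyX rmorph_nat.
Qed.

Lemma coef_falling_oppX (K : numFieldType) n j :
  (falling (- 'X) n : {poly K})`_j = (-1) ^+ j * (stirling1 n j)%:~R.
Proof.
have -> : falling (- 'X) n = falling 'X n \Po (- 'X) :> {poly K}.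
  by rewrite falling_comp comp_polyX.
rewrite coef_comp_oppX -falling_map_int coef_map /=.
congr (_ * _%:~R); rewrite /stirling1 /falling; congr (polyseq _)`_j.
by apply: eq_bigr => i _; rewrite -(rmorph_nat (@polyC int)) natz.
Qed.

(** Under 'X |-> - 'X the n + m factors of the product for order n + m + 1 and
    argument n + 1 - t become n - t - 'X, n - 1 - t - 'X, ...: the first n are,
    up to sign and order, those of the product for order n + 1 and argument t,
    and the other m are those of falling (- t - 'X) m. *)
Lemma norlund_reflected (K : numFieldType) (t : K) n m :
  'C(n + m, m)%:R * norlund (n + m).+1%:R m (n.+1%:R - t) =
  (falling (t%:P + 'X - 1) n * falling (- t%:P - 'X) m)`_n.
Proof.
rewrite -coef_falling_norlund ?leq_addl // addnK.
have -> : falling (t%:P + 'X - 1) n * falling (- t%:P - 'X) m =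
  (-1) ^+ n *: (falling ((n.+1%:R - t)%:P + 'X - 1) (n + m) \Po (- 'X)).
  rewrite falling_comp comp_polyB comp_polyD comp_polyC comp_polyX.
  rewrite -polyC1 comp_polyC fallingD.
  have -> : (n.+1%:R - t)%:P - 'X - 1%:P = n%:R - 1 - (t%:P + 'X - 1) :> {poly K}.
    by rewrite polyCB rmorph_nat -natr1 polyC1; ring.
  rewrite falling_reflect.
  rewrite -mul_polyC rmorphXn rmorphN /= polyC1 !mulrA -exprD -signr_odd.
  by rewrite oddD addbb expr0 mul1r; congr (_ * falling _ _); ring.
rewrite coefZ coef_comp_oppX mulrA -exprD -signr_odd oddD addbb mul1r //.
Qed.

Lemma rising_opp_nat_div (K : numFieldType) n j :
  rising (- n%:R : K) j / j`!%:R = (-1) ^+ j * 'C(n, j)%:R.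
Proof.
rewrite risingE opprK falling_nat -bin_ffact natrM.
by rewrite mulrA mulfK // fact_neq0.
Qed.

Lemma rising_nat_div (K : numFieldType) n j :
  rising (n.+1%:R : K) j / j`!%:R = 'C(n + j, j)%:R.
Proof.
apply: (canLR (mulfK (fact_neq0 K j))); rewrite -natrM bin_ffact.
elim: j => [|j IH]; first by rewrite /rising big_ord0 ffactn0.
rewrite /rising big_ord_recr /= -/(rising _ _) IH addnS ffactSS natrM mulrC.
by rewrite -natrD addSn.
Qed.

(** As rising (- n) j / j! = (-1)^j 'C(n, j), the summand is q`_j times a
    coefficient of the falling factorial; the two ranges of summation differ
    only by zero terms, since 'C(n, j) = 0 for j > n and q`_j = 0 for j > m. *)
Lemma norlund_convolution (K : numFieldType) (t : K) n m (q : {poly K}) :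
  (size q <= m.+1)%N ->
  (falling (t%:P + 'X - 1) n * q)`_n =
  \sum_(j < m.+1) norlund n.+1%:R j t * (rising (- n%:R) j / j`!%:R) *
    ((-1) ^+ j * q`_j).
Proof.
move=> sz_q; rewrite mulrC coefM.
pose F j := q`_j * ('C(n, j)%:R * norlund n.+1%:R j t).
transitivity (\sum_(j < n.+1) F j).
  by apply: eq_bigr => j _; rewrite /F -coef_falling_norlund // -ltnS.
transitivity (\sum_(j < m.+1) F j); last first.
  apply: eq_bigr => j _; rewrite /F rising_opp_nat_div.
  transitivity ((-1) ^+ j * (-1) ^+ j * (q`_j * ('C(n, j)%:R * norlund n.+1%:R j t))).
    by rewrite -expr2 sqrr_sign mul1r.
  ring.
have vanish k N : (forall j, (k <= j)%N -> F j = 0) -> (k <= N)%N ->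
    \sum_(j < N) F j = \sum_(j < k) F j.
  move=> F0 le_kN; rewrite (big_ord_widen N F le_kN) [RHS]big_mkcond.
  by apply: eq_bigr => j _; case: ltnP => // /F0.
have Fm j : (m.+1 <= j)%N -> F j = 0.
  by move=> lt_mj; rewrite /F nth_default ?mul0r // (leq_trans sz_q).
have Fn j : (n.+1 <= j)%N -> F j = 0.
  by move=> lt_nj; rewrite /F bin_small // mul0r mulr0.
by case/orP: (leq_total m.+1 n.+1) => le; [apply: vanish | apply/esym/vanish].
Qed.

(** * Extension from integers to arbitrary orders *)

Definition polyfun (K : numFieldType) (F : K -> K) : Prop :=
  exists p : {poly K}, forall x, F x = p.[x].

Section PolyFun.
Variable K : numFieldType.
Implicit Types F G : K -> K.

Lemma polyfun_cst c : polyfun (fun _ : K => c).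
Proof. by exists c%:P => x; rewrite hornerC. Qed.

Lemma polyfun_id : polyfun (fun x : K => x).
Proof. by exists 'X => x; rewrite hornerX. Qed.

Lemma polyfunD F G : polyfun F -> polyfun G -> polyfun (fun x => F x + G x).
Proof. by move=> [p Fp] [q Gq]; exists (p + q) => x; rewrite hornerD Fp Gq. Qed.

Lemma polyfunM F G : polyfun F -> polyfun G -> polyfun (fun x => F x * G x).
Proof. by move=> [p Fp] [q Gq]; exists (p * q) => x; rewrite hornerM Fp Gq. Qed.

Lemma polyfunN F : polyfun F -> polyfun (fun x => - F x).
Proof. by move=> [p Fp]; exists (- p) => x; rewrite hornerN Fp. Qed.

Lemma polyfunX F n : polyfun F -> polyfun (fun x => F x ^+ n).
Proof. by move=> [p Fp]; exists (p ^+ n) => x; rewrite horner_exp Fp. Qed.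

Lemma polyfun_sum n (F : 'I_n -> K -> K) :
  (forall i, polyfun (F i)) -> polyfun (fun x => \sum_(i < n) F i x).
Proof.
move=> Fpoly; elim: (index_enum _) => [|i r [p Hp]].
  by exists 0 => x; rewrite big_nil horner0.
have [q Hq] := Fpoly i.
by exists (q + p) => x; rewrite big_cons hornerD Hp Hq.
Qed.

Lemma polyfun_prod n (F : 'I_n -> K -> K) :
  (forall i, polyfun (F i)) -> polyfun (fun x => \prod_(i < n) F i x).
Proof.
move=> Fpoly; elim: (index_enum _) => [|i r [p Hp]].
  by exists 1 => x; rewrite big_nil hornerC.
have [q Hq] := Fpoly i.
by exists (q * p) => x; rewrite big_cons hornerM Hp Hq.
Qed.

Lemma polyfun_rising F n : polyfun F -> polyfun (fun x => rising (F x) n).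
Proof.
by move=> Fp; apply: polyfun_prod => i; apply/polyfunD/polyfun_cst.
Qed.

Lemma polyfun_norlund F G k :
  polyfun F -> polyfun G -> polyfun (fun x => norlund (F x) k (G x)).
Proof.
move=> Fp Gp; apply: (polyfunM (polyfun_cst _)); apply: polyfun_sum => i.
apply: polyfunM; last exact/polyfunM/polyfun_cst/polyfunX.
apply: polyfun_sum => n; apply/polyfunM/polyfun_cst/polyfunM/polyfun_cst.
by apply: polyfun_prod => j; apply/polyfunD/polyfun_cst/polyfunN.
Qed.

(** In characteristic zero the positive integers are infinitely many points. *)
Lemma polyfun_eq F G : polyfun F -> polyfun G ->
  (forall n, F n.+1%:R = G n.+1%:R) -> F =1 G.
Proof.
move=> [p Fp] [q Gq] FG x; rewrite Fp Gq.
suff : p - q == 0 by move=> /eqP/subr0_eq ->.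
apply/contraT => pq_neq0.
pose s : seq K := [seq n.+1%:R | n <- iota 0 (size (p - q))].
have: (size s < size (p - q)%R)%N.
  apply: max_poly_roots => //.
    by apply/allP => _ /mapP[n _ ->]; rewrite rootE hornerD hornerN -Fp -Gq FG subrr.
  by rewrite map_inj_uniq ?iota_uniq // => i j /eqP; rewrite eqr_nat eqSS => /eqP.
by rewrite size_map size_iota ltnn.
Qed.

End PolyFun.

(** * The two identities *)

Lemma size_polyC_subX (K : numFieldType) (a : K) : size (a%:P - 'X : {poly K}) = 2.
Proof. by rewrite -opprB size_polyN size_XsubC. Qed.

(** Both sides are the coefficient of 'X^n in
    falling (t + 'X - 1) n * falling (- t - 'X) m. *)
Lemma norlund_rising_stirling_nat (K : numFieldType) (t : K) m n :
  rising n.+1%:R m / m`!%:R * norlund (n.+1%:R + m%:R) m (n.+1%:R - t) =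
  \sum_(j < m.+1) norlund n.+1%:R j t * (rising (1 - n.+1%:R) j / j`!%:R) *
     \sum_(k < (m - j).+1)
       (-1) ^+ k * 'C(m, k)%:R * (stirling1 (m - k) j)%:~R * rising t k.
Proof.
rewrite rising_nat_div -natrD addSn norlund_reflected.
rewrite (@norlund_convolution _ _ _ m); last first.
  by rewrite size_falling // -polyCN size_polyC_subX.
have -> : 1 - n.+1%:R = - n%:R :> K by rewrite -natr1; ring.
apply: eq_bigr => j _; congr (_ * _).
rewrite falling_Vandermonde coef_sum mulr_sumr.
rewrite (big_ord_widen m.+1 (fun k => (-1) ^+ k * 'C(m, k)%:R *
   (stirling1 (m - k) j)%:~R * rising t k)); last by rewrite ltnS leq_subr.
rewrite [RHS]big_mkcond; apply: eq_bigr => k _.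
rewrite -polyCN falling_polyC -(rmorph_nat (@polyC K)) -polyCM coefCM.
case: ltnP => lt_jmk.
  rewrite coef_falling_oppX risingE.
  have sign_sq i : (-1) ^+ i * (-1) ^+ i = 1 :> K by rewrite -expr2 sqrr_sign.
  transitivity ((-1) ^+ j * (-1) ^+ j * ('C(m, k)%:R * falling (- t) k *
     (stirling1 (m - k) j)%:~R)); first by ring.
  transitivity ((-1) ^+ k * (-1) ^+ k * ('C(m, k)%:R * falling (- t) k *
     (stirling1 (m - k) j)%:~R)); last by ring.
  by rewrite !sign_sq.
(* For k > m - j the degree m - k of the factor in 'X is less than j. *)
rewrite nth_default ?mulr0 // (leq_trans (size_falling _ _)) //.
  by rewrite size_polyN size_polyX.
by have := ltn_ord k; lia.
Qed.

(** Both sides are the coefficient of 'X^n in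
    falling (t + 'X - 1) n * falling (- 'X) m, divided by m!. *)
Lemma norlund_gbinom_stirling_nat (K : numFieldType) (t : K) m n :
  1 / m`!%:R * \sum_(j < m.+1) (stirling1 m j)%:~R * norlund n.+1%:R j t *
     (rising (1 - n.+1%:R) j / j`!%:R) =
  \sum_(j < m.+1) gbinom t (m - j) *
     norlund (n.+1%:R + j%:R) j (n.+1%:R - t) *
     (rising n.+1%:R j / (j`!%:R ^+ 2)).
Proof.
have -> : 1 - n.+1%:R = - n%:R :> K by rewrite -natr1; ring.
transitivity (1 / m`!%:R * (falling (t%:P + 'X - 1) n * falling (- 'X) m)`_n).
  congr (_ * _); rewrite (@norlund_convolution _ _ _ m); last first.
    by rewrite size_falling // size_polyN size_polyX.
  apply: eq_bigr => j _; rewrite coef_falling_oppX [(-1) ^+ j * _]mulrA.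
  by rewrite -expr2 sqrr_sign mul1r; ring.
(* This splitting makes Vandermonde produce the reflected products. *)
have -> : - 'X = (- t%:P - 'X) + t%:P :> {poly K} by ring.
rewrite (falling_Vandermonde (- t%:P - 'X)) mulr_sumr coef_sum mulr_sumr.
apply: eq_bigr => j _.
have le_jm : (j <= m)%N by rewrite -ltnS.
rewrite falling_polyC -(rmorph_nat (@polyC K)) mulrA coefMC.
rewrite [falling _ n * _]mulrCA coefCM -norlund_reflected.
rewrite -natrD addSn gbinomE -rising_nat_div -(bin_fact le_jm) !natrM.
field.
by rewrite !fact_neq0 pnatr_eq0 -lt0n bin_gt0 le_jm.
Qed.

Lemma norlund_rising_stirling (K : numFieldType) (m : nat) (t x : K) :
  rising (t - x + 1) m / m`!%:R * norlund (t - x + m%:R + 1) m (1 - x)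
   = \sum_(j < m.+1)
       norlund (t - x + 1) j t * (rising (x - t) j / j`!%:R) *
       \sum_(k < (m - j).+1)
         (-1) ^+ k * 'C(m, k)%:R * (stirling1 (m - k) j)%:~R * rising t k.
Proof.
have gE : t - x + m%:R + 1 = (t - x + 1) + m%:R by ring.
have xE : 1 - x = (t - x + 1) - t by ring.
have tE : x - t = 1 - (t - x + 1) by ring.
rewrite gE xE tE; move: (t - x + 1) => g.
pose c j := \sum_(k < (m - j).+1)
  (-1) ^+ k * 'C(m, k)%:R * (stirling1 (m - k) j)%:~R * rising t k.
apply: (@polyfun_eq K
  (fun g => rising g m / m`!%:R * norlund (g + m%:R) m (g - t))
  (fun g => \sum_(j < m.+1) norlund g j t * (rising (1 - g) j / j`!%:R) * c j)).
- apply: polyfunM; first exact/polyfunM/polyfun_cst/polyfun_rising/polyfun_id.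
  by apply: polyfun_norlund; apply/polyfunD/polyfun_cst/polyfun_id.
- apply: polyfun_sum => j; apply/polyfunM/polyfun_cst/polyfunM.
    by apply: polyfun_norlund; [apply: polyfun_id | apply: polyfun_cst].
  apply/polyfunM/polyfun_cst/polyfun_rising/(polyfunD (polyfun_cst _)).
  exact/polyfunN/polyfun_id.
- by move=> n; apply: norlund_rising_stirling_nat.
Qed.

Lemma norlund_gbinom_stirling (K : numFieldType) (m : nat) (t x : K) :
  1 / m`!%:R *
     \sum_(j < m.+1)
       (stirling1 m j)%:~R * norlund (t + x) j t *
       (rising (1 - t - x) j / j`!%:R)
   = \sum_(j < m.+1)
       gbinom t (m - j) * norlund (t + x + j%:R) j x *
       (rising (t + x) j / (j`!%:R ^+ 2)).
Proof.
have tE : 1 - t - x = 1 - (t + x) by ring.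
have [g xE] : exists g, x = g - t by exists (t + x); ring.
have gE : t + x = g by rewrite xE; ring.
rewrite tE gE {}xE {x tE gE}.
apply: (@polyfun_eq K
  (fun g => 1 / m`!%:R * \sum_(j < m.+1) (stirling1 m j)%:~R * norlund g j t *
     (rising (1 - g) j / j`!%:R))
  (fun g => \sum_(j < m.+1) gbinom t (m - j) * norlund (g + j%:R) j (g - t) *
       (rising g j / (j`!%:R ^+ 2)))).
- apply/(polyfunM (polyfun_cst _))/polyfun_sum => j; apply: polyfunM.
    apply: (polyfunM (polyfun_cst _)).
    by apply: polyfun_norlund; [apply: polyfun_id | apply: polyfun_cst].
  apply/polyfunM/polyfun_cst/polyfun_rising/(polyfunD (polyfun_cst _)).
  exact/polyfunN/polyfun_id.
- apply: polyfun_sum => j; apply: polyfunM.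
    apply: (polyfunM (polyfun_cst _)).
    by apply: polyfun_norlund; apply/polyfunD/polyfun_cst/polyfun_id.
  exact/polyfunM/polyfun_cst/polyfun_rising/polyfun_id.
- by move=> n; apply: norlund_gbinom_stirling_nat.
Qed.

Theorem theorem6 (R : realType) (m : nat) (t x : R[i]) :
  (rising (t - x + 1) m / m`!%:R * norlund (t - x + m%:R + 1) m (1 - x)
   = \sum_(j < m.+1)
       norlund (t - x + 1) j t * (rising (x - t) j / j`!%:R) *
       \sum_(k < (m - j).+1)
         (-1) ^+ k * 'C(m, k)%:R * (stirling1 (m - k) j)%:~R * rising t k)
  /\
  (1 / m`!%:R *
     \sum_(j < m.+1)
       (stirling1 m j)%:~R * norlund (t + x) j t *
       (rising (1 - t - x) j / j`!%:R)
   = \sum_(j < m.+1)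
       gbinom t (m - j) * norlund (t + x + j%:R) j x *
       (rising (t + x) j / (j`!%:R ^+ 2))).
Proof. by split; [apply: norlund_rising_stirling | apply: norlund_gbinom_stirling]. Qed.
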